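(* Let $\Gamma$ be a finite simplicial connected graph that is not a join, and let $H$ be an infinite proper malnormal subgroup of the right-angled Coxeter group $G_\Gamma$. Then $H$ is a join-free subgroup of $G_\Gamma$.
   Context: Right-angled Coxeter group: for a finite simplicial graph $\Gamma$ with vertex set $S$, $G_\Gamma$ is the group generated by $S$ with relations $s^2=1$ for all $s\in S$ and $st=ts$ whenever $s,t$ are adjacent vertices. For an induced subgraph $\Lambda$ of $\Gamma$, $G_\Lambda$ is identified with the (special) subgroup of $G_\Gamma$ generated by the vertices of $\Lambda$. Join: the join of two non-empty graphs $\Gamma_1,\Gamma_2$ is obtained by connecting every vertex of $\Gamma_1$ to every vertex of $\Gamma_2$ by an edge. A graph is a join if it decomposes in this way. A join subgroup of $G_\Gamma$ is a subgroup $G_J$ where $J$ is an induced subgraph of $\Gamma$ that decomposes as a join. Join-free: a subgroup $H\le G_\Gamma$ is join-free if $H$ is infinite and none of the infinite order elements of $H$ are conjugate (in $G_\Gamma$) into a join subgroup. Malnormal: a subgroup $H\le G$ is malnormal if $gHg^{-1}\cap H$ is trivial for each $g\in G\setminus H$. *)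

(* Defs.v *)
From HB Require Import structures.
From mathcomp Require Import all_boot.
From mathcomp Require Import boolp classical_sets functions cardinality.

Set Implicit Arguments.
Unset Strict Implicit.
Unset Printing Implicit Defensive.

Local Open Scope quotient_scope.
Local Open Scope classical_set_scope.
Local Open Scope group_scope.

(** * Groups given by generators and relations *)

Section Presentation.
Variable X : choiceType.

(* The letter (x, false) stands for x and (x, true) for its formal inverse. *)
Definition gword := seq (X * bool).

Definition letter_inv (a : X * bool) : X * bool := (a.1, ~~ a.2).
Definition gword_inv (w : gword) : gword := rev (map letter_inv w).

Variable R : gword -> gword -> Prop.

(* The congruence generated by the relations [u = v] for [R u v], together
   with the cancellations x x^-1 = x^-1 x = 1. *)
Inductive pres_eq : gword -> gword -> Prop :=
| pres_refl u : pres_eq u u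
| pres_sym u v : pres_eq u v -> pres_eq v u
| pres_trans u v w : pres_eq u v -> pres_eq v w -> pres_eq u w
| pres_cancel p q a : pres_eq (p ++ [:: a; letter_inv a] ++ q) (p ++ q)
| pres_rel p q u v : R u v -> pres_eq (p ++ u ++ q) (p ++ v ++ q).

Lemma pres_eq_ctx p q u v : pres_eq u v -> pres_eq (p ++ u ++ q) (p ++ v ++ q).
Proof.
elim=> {u v} [u|u v _ /pres_sym//|u v w _ uv _ vw|p' q' a|p' q' u v Ruv].
- exact: pres_refl.
- exact: pres_trans uv vw.
- by have := pres_cancel (p ++ p') (q' ++ q) a; rewrite -!catA.
- by have := pres_rel (p ++ p') (q' ++ q) Ruv; rewrite -!catA.
Qed.

Lemma pres_eq_cat u u' v v' :
  pres_eq u u' -> pres_eq v v' -> pres_eq (u ++ v) (u' ++ v').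
Proof.
move=> /(pres_eq_ctx [::] v) uu' /(pres_eq_ctx u' [::]).
by rewrite !cats0; exact: pres_trans uu'.
Qed.

Lemma letter_invK : involutive letter_inv.
Proof. by case=> x b; rewrite /letter_inv negbK. Qed.

Lemma gword_invK : involutive gword_inv.
Proof.
by move=> w; rewrite /gword_inv map_rev revK -map_comp (eq_map letter_invK) map_id.
Qed.

Lemma pres_eq_invr w : pres_eq (w ++ gword_inv w) [::].
Proof.
elim: w => [|a w IHw]; first exact: pres_refl.
rewrite /gword_inv map_cons rev_cons -cats1.
have /= := pres_eq_ctx [:: a] [:: letter_inv a] IHw.
rewrite -!catA => aw; apply: pres_trans aw _.
exact: (pres_cancel [::] [::]).
Qed.

Lemma pres_eq_invl w : pres_eq (gword_inv w ++ w) [::].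
Proof. by have := pres_eq_invr (gword_inv w); rewrite gword_invK. Qed.

Lemma pres_eq_inv u v : pres_eq u v -> pres_eq (gword_inv u) (gword_inv v).
Proof.
move=> uv.
have := pres_eq_cat (pres_refl (gword_inv u)) (pres_eq_invr v).
rewrite cats0 => /pres_sym h; apply: pres_trans h _.
rewrite catA; apply: (pres_eq_cat (v' := gword_inv v)  (u' := [::])); last exact: pres_refl.
apply: pres_trans (pres_eq_invl u); apply: pres_eq_cat; first exact: pres_refl.
exact: pres_sym.
Qed.

Definition pres_eqb : rel gword := fun u v => `[< pres_eq u v >].

Lemma pres_eqb_refl : reflexive pres_eqb.
Proof. by move=> u; apply/asboolP; exact: pres_refl. Qed.

Lemma pres_eqb_sym : symmetric pres_eqb.
Proof. by move=> u v; apply/asboolP/asboolP => /pres_sym. Qed.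

Lemma pres_eqb_trans : transitive pres_eqb.
Proof.
by move=> v u w /asboolP uv /asboolP vw; apply/asboolP; exact: pres_trans uv vw.
Qed.

Canonical pres_equiv := EquivRel pres_eqb pres_eqb_refl pres_eqb_sym pres_eqb_trans.

Definition presented := {eq_quot pres_equiv}.
HB.instance Definition _ := Choice.on presented.

Definition pres_class (w : gword) : presented := \pi w.

Lemma pres_classP u v : pres_class u = pres_class v <-> pres_eq u v.
Proof. by split=> [/eqmodP/asboolP|uv]; last apply/eqmodP/asboolP. Qed.

Lemma pres_class_surj (a : presented) : exists w, a = pres_class w.
Proof. by exists (repr a); rewrite /pres_class reprK. Qed.

Lemma pres_eq_repr w : pres_eq (repr (pres_class w)) w.
Proof. by apply/pres_classP; rewrite /pres_class reprK. Qed.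

Definition pres_one : presented := pres_class [::].
Definition pres_mul (a b : presented) := pres_class (repr a ++ repr b).
Definition pres_inv (a : presented) := pres_class (gword_inv (repr a)).

Lemma pres_mulE u v : pres_mul (pres_class u) (pres_class v) = pres_class (u ++ v).
Proof. by apply/pres_classP; apply: pres_eq_cat; exact: pres_eq_repr. Qed.

Lemma pres_invE u : pres_inv (pres_class u) = pres_class (gword_inv u).
Proof. by apply/pres_classP; apply: pres_eq_inv; exact: pres_eq_repr. Qed.

Lemma pres_mulA : associative pres_mul.
Proof.
move=> a b c; have [u ->] := pres_class_surj a.
have [v ->] := pres_class_surj b; have [w ->] := pres_class_surj c.
by rewrite !pres_mulE catA.
Qed.

Lemma pres_mul1 : left_id pres_one pres_mul.
Proof. by move=> a; have [u ->] := pres_class_surj a; rewrite pres_mulE. Qed.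

Lemma pres_mulr1 : right_id pres_one pres_mul.
Proof. by move=> a; have [u ->] := pres_class_surj a; rewrite pres_mulE cats0. Qed.

Lemma pres_mulV : left_inverse pres_one pres_inv pres_mul.
Proof.
move=> a; have [u ->] := pres_class_surj a; rewrite pres_invE pres_mulE.
by apply/pres_classP; exact: pres_eq_invl.
Qed.

Lemma pres_mulrV : right_inverse pres_one pres_inv pres_mul.
Proof.
move=> a; have [u ->] := pres_class_surj a; rewrite pres_invE pres_mulE.
by apply/pres_classP; exact: pres_eq_invr.
Qed.

HB.instance Definition _ :=
  isGroup.Build presented pres_mulA pres_mul1 pres_mulr1 pres_mulV pres_mulrV.

Definition pres_gen (x : X) : presented := pres_class [:: (x, false)].

End Presentation.

(* The universal property of the presentation. *)
Definition eval_gword (X : choiceType) (K : groupType) (f : X -> K)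
    (w : gword X) : K :=
  \prod_(a <- w) (if a.2 then (f a.1)^-1 else f a.1).

Lemma presented_lift (X : choiceType) (R : gword X -> gword X -> Prop)
    (K : groupType) (f : X -> K) :
  (forall u v, R u v -> eval_gword f u = eval_gword f v) ->
  exists! phi : presented R -> K,
    (forall a b, phi (a * b) = phi a * phi b) /\
    (forall x, phi (pres_gen R x) = f x).
Proof.
move=> Rf.
have ev_cat u v : eval_gword f (u ++ v) = eval_gword f u * eval_gword f v.
  by rewrite /eval_gword big_cat.
have ev_eq u v : pres_eq R u v -> eval_gword f u = eval_gword f v.
  elim=> {u v} [//|u v _ ->//|u v w _ -> _ ->//|p q [x b]|p q u v /Rf uv].
    rewrite !ev_cat; congr (_ * _); rewrite -[RHS]mul1g; congr (_ * _).
    rewrite /eval_gword !big_cons big_nil mulg1 /=.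
    by case: b; rewrite /= ?mulgV ?mulVg.
  by rewrite !ev_cat uv.
exists (fun a => eval_gword f (repr a)); split; first split.
- move=> a b; rewrite -ev_cat; apply: ev_eq; exact: pres_eq_repr.
- move=> x; rewrite (ev_eq _ _ (pres_eq_repr R [:: (x, false)])).
  by rewrite /eval_gword big_seq1.
move=> phi [phiM phix]; apply/funext => a; rewrite -[in RHS](reprK a).
have phi1 : phi 1 = 1 by apply: (mulgI (phi 1)); rewrite -phiM !mulg1.
change (eval_gword f (repr a) = phi (pres_class R (repr a))).
elim: (repr a) => [|[x b] w IHw]; first by rewrite /eval_gword big_nil -phi1.
rewrite -cat1s ev_cat IHw -(pres_mulE R [:: (x, b)] w) phiM; congr (_ * _).
rewrite /eval_gword big_seq1 /=; case: b => /=; rewrite -phix //.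
apply: (mulgI (phi (pres_gen R x))); rewrite mulgV -phiM -phi1; congr phi.
by rewrite [RHS]pres_mulE; apply/esym/pres_classP; exact: (pres_eq_invr R [:: (x, false)]).
Qed.

(** * Subgroups of a possibly infinite group *)

Section Subgroups.
Variable G : groupType.
Implicit Types (H A : set G) (x g : G).

Definition is_subgroup H : Prop :=
  [/\ H 1, forall x y, H x -> H y -> H (x * y) & forall x, H x -> H x^-1].

Definition generated A : set G := smallest is_subgroup A.

Definition malnormal H : Prop :=
  forall g, ~ H g -> [set g * h * g^-1 | h in H] `&` H = [set 1].

Definition infinite_order x : Prop := forall n, (0 < n)%N -> x ^+ n <> 1.

Definition conjugate_into x H : Prop := exists g, H (g * x * g^-1).

End Subgroups.

(** * Finite simplicial graphs *)

Record sgraph := SGraph {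
  vertex :> finType;
  adj : rel vertex;
  adj_sym : symmetric adj;
  adj_irr : irreflexive adj
}.

Definition connected_graph (Gamma : sgraph) : Prop :=
  forall x y : Gamma, connect (@adj Gamma) x y.

Section Induced.
Variables (Gamma : sgraph) (J : {set Gamma}).

Definition induced_adj : rel {x : Gamma | x \in J} :=
  fun x y => adj (val x) (val y).

Lemma induced_adj_sym : symmetric induced_adj.
Proof. by move=> x y; exact: adj_sym. Qed.

Lemma induced_adj_irr : irreflexive induced_adj.
Proof. by move=> x; exact: adj_irr. Qed.

Definition induced : sgraph := SGraph induced_adj_sym induced_adj_irr.

End Induced.

Definition is_join (Gamma : sgraph) : Prop :=
  exists A B : {set Gamma},
    [/\ A != finset.set0, B != finset.set0, [disjoint A & B]%B,
        (A :|: B = [set: Gamma])%SET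
      & forall a b, a \in A -> b \in B -> adj a b].

(** * Right-angled Coxeter groups *)

Section RACG.
Variable Gamma : sgraph.

Inductive racg_rel : gword Gamma -> gword Gamma -> Prop :=
| racg_sq s : racg_rel [:: (s, false); (s, false)] [::]
| racg_comm s t : adj s t ->
    racg_rel [:: (s, false); (t, false)] [:: (t, false); (s, false)].

Definition racg : groupType := presented racg_rel.

Definition racg_gen (s : Gamma) : racg := pres_gen racg_rel s.

Definition special_subgroup (J : {set Gamma}) : set racg :=
  generated [set racg_gen s | s in [set` J]].

Definition join_subgroup (K : set racg) : Prop :=
  exists2 J : {set Gamma}, is_join (induced J) & K = special_subgroup J.

Definition join_free (H : set racg) : Prop :=
  infinite_set H /\
  forall h, H h -> infinite_order h ->
    ~ exists2 K, join_subgroup K & conjugate_into h K.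

End RACG.

(* Main.v *)
(** If a nontrivial element of a malnormal subgroup [H] commutes with [g], then
    [g] lies in [H]. Up to conjugating [H], a counterexample contains a nontrivial
    [h = a * b] with [a], [b] in the two commuting factors of a join subgroup.
    One of them, say [a], is nontrivial; it commutes with [h], hence lies in
    [H], and so does the whole other factor, which contains a standard
    generator. Commutation propagates membership in [H] along the edges of the
    connected graph, so that [H] is the whole group. *)
Require Import Defs.
From mathcomp Require Import all_boot.
From mathcomp Require Import boolp classical_sets functions cardinality.

Set Implicit Arguments.
Unset Strict Implicit.
Unset Printing Implicit Defensive.

Local Open Scope classical_set_scope.
Local Open Scope group_scope.

Section Groups.
Variable G : groupType.
Implicit Types (H A B : set G) (x y g h : G).

Definition commutation_closed H : Prop :=
  forall h g, H h -> h <> 1 -> commute g h -> H g.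

(** For [g] outside [H], the element [h = g * h * g^-1] would be a nontrivial member of a trivial
    intersection. *)
Lemma malnormal_commutation_closed H : malnormal H -> commutation_closed H.
Proof.
move=> malH h g Hh h1 cgh; apply: contrapT => /malH gH.
apply: h1; suff : [set 1] h by [].
by rewrite -gH; split=> //; exists h => //; rewrite cgh mulgK.
Qed.

Lemma is_subgroup_conj H g : is_subgroup H -> is_subgroup [set x | H (x ^ g)].
Proof.
case=> H1 HM HV; split=> /= [|x y Hx Hy|x Hx].
- by rewrite conj1g.
- by rewrite conjMg; exact: HM.
- by rewrite conjVg; exact: HV.
Qed.

(** Conjugation is an automorphism. This allows the join subgroup to stay fixed while [H] is
    conjugated. *)
Lemma commutation_closed_conj H g :
  commutation_closed H -> commutation_closed [set x | H (x ^ g)].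
Proof.
move=> ccH h x /= Hh h1 cxh; apply: (ccH _ _ Hh).
  by rewrite -(conj1g g) => /conjg_inj.
by rewrite /commute -!conjMg cxh.
Qed.

Lemma generated_sub A H : is_subgroup H -> A `<=` H -> generated A `<=` H.
Proof. by move=> sH AH; exact: smallest_sub. Qed.

Lemma sub_generated A : A `<=` generated A.
Proof. exact: sub_smallest. Qed.

Lemma is_subgroup_generated A : is_subgroup (generated A).
Proof.
split=> [B [[]]//|x y Ax Ay B AB|x Ax B AB].
- by case: (AB) => -[_ BM _] _; apply: BM; [exact: Ax|exact: Ay].
- by case: (AB) => -[_ _ BV] _; apply: BV; exact: Ax.
Qed.

Lemma is_subgroup_centraliser A :
  is_subgroup [set x | forall y, A y -> commute x y].
Proof.
split=> /= [y _|x z cx cz y Ay|x cx y Ay].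
- exact/commute_sym/commute1.
- by apply/commute_sym/commuteM; apply/commute_sym; [exact: cx|exact: cz].
- by apply/commute_sym/commuteV/commute_sym; exact: cx.
Qed.

Lemma commute_generated A B :
  (forall x y, A x -> B y -> commute x y) ->
  forall x y, generated A x -> generated B y -> commute x y.
Proof.
move=> cAB x y Ax By.
(* The centraliser of [generated B] is a subgroup, so it suffices to treat [A]; then the centraliser
   of [A] reduces [generated B] to [B]. *)
apply: (generated_sub (is_subgroup_centraliser _) _ Ax) (By) => a Aa z Bz.
apply/commute_sym.
apply: (generated_sub (is_subgroup_centraliser A) _ Bz) => // b Bb a' Aa'.
exact/commute_sym/cAB.
Qed.

(** The products contain both generating sets, and commutation of the factors makes them a
    subgroup. *)
Lemma generatedU_commute A B :
  (forall x y, A x -> B y -> commute x y) ->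
  generated (A `|` B) `<=`
    [set x * y | x in generated A & y in generated B].
Proof.
move=> cAB; have cgAB := commute_generated cAB.
have [A1 AM AV] := is_subgroup_generated A.
have [B1 BM BV] := is_subgroup_generated B.
apply: generated_sub; first split.
- by exists 1 => //; exists 1; rewrite ?mulg1.
- move=> _ _ [a Aa [b Bb <-]] [a' Aa' [b' Bb' <-]].
  exists (a * a'); first exact: AM.
  exists (b * b'); first exact: BM.
  by rewrite -!mulgA; congr (_ * _); rewrite !mulgA; congr (_ * _); exact: cgAB.
- move=> _ [a Aa [b Bb <-]].
  exists a^-1; first exact: AV.
  exists b^-1; first exact: BV.
  by rewrite -invgM; congr (_^-1); apply/esym/cgAB.
- move=> x [Ax|Bx].
  + by exists x; [exact: sub_generated|exists 1; rewrite ?mulg1].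
  + by exists 1 => //; exists x; [exact: sub_generated|rewrite mul1g].
Qed.

Lemma commutation_closed_generatedU H A B h :
  commutation_closed H -> (forall x y, A x -> B y -> commute x y) ->
  generated (A `|` B) h -> H h -> h <> 1 -> A `<=` H \/ B `<=` H.
Proof.
move=> ccH cAB ABh Hh h1.
have [a Aa [b Bb def_h]] := generatedU_commute cAB ABh; subst h.
have cab := commute_generated cAB Aa Bb.
have [a1|a1] := pselect (a = 1).
  (* Here [h = b], which commutes with all of [A]. *)
  left=> x Ax; rewrite a1 mul1g in Hh h1; apply: (ccH _ _ Hh h1).
  exact: (commute_generated cAB (sub_generated Ax) Bb).
(* Now [a] is the nontrivial element of [H] that commutes with [B]; it lies in [H] because it
   commutes with [h = a * b]. *)
right=> y By; apply: (ccH a) => //.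
  by apply: (ccH _ _ Hh h1); apply: commuteM.
exact/commute_sym/(commute_generated cAB Aa (sub_generated By)).
Qed.

End Groups.

Section RightAngledCoxeterGroups.
Variable Gamma : sgraph.
Implicit Types (s t : Gamma) (H : set (racg Gamma)).

(* All relators have even length, so the parity of the length of a word is an
   invariant of the element that it represents. *)
Lemma racg_gen_neq1 s : racg_gen s <> 1.
Proof.
suff par u v : pres_eq (@racg_rel Gamma) u v -> odd (size u) = odd (size v).
  by move/pres_classP/par.
elim=> {u v} [//|//|u v w _ -> _ ->//|p q a|p q u v uv].
  by rewrite !size_cat !oddD.
by rewrite !size_cat !oddD; case: uv.
Qed.

Lemma commute_racg_gen s t : adj s t -> commute (racg_gen s) (racg_gen t).
Proof.
move=> st; rewrite /commute /racg_gen /pres_gen.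
rewrite [LHS]pres_mulE [RHS]pres_mulE; apply/pres_classP.
exact: (pres_rel [::] [::] (racg_comm st)).
Qed.

Lemma racg_genT : generated [set racg_gen s | s in [set: Gamma]] = setT.
Proof.
apply/seteqP; split=> // x _; have [w ->] := pres_class_surj x.
have [G1 GM GV] := is_subgroup_generated [set racg_gen s | s in [set: Gamma]].
have gen s : generated [set racg_gen s | s in [set: Gamma]] (racg_gen s).
  by apply: sub_generated; exists s.
elim: w => [//|[s b] w IHw].
rewrite -cat1s -(pres_mulE _ [:: (s, b)] w); apply: GM => //.
(* The letter [(s, true)] represents the inverse of the generator. *)
case: b; last exact: gen.
by have := GV _ (gen s); rewrite /racg_gen /pres_gen [_^-1]pres_invE.
Qed.

Lemma commutation_closed_racg_gen H s :
  connected_graph Gamma -> is_subgroup H -> commutation_closed H ->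
  H (racg_gen s) -> H = setT.
Proof.
move=> conn sH ccH Hs; apply/seteqP; split=> //; rewrite -racg_genT.
apply: generated_sub => // _ [t _ <-].
have /connectP[p st ->] := conn s t.
elim: p s Hs st => [//|u p IHp] s Hs /= /andP[su up]; apply: IHp up.
by apply: (ccH _ _ Hs (@racg_gen_neq1 s)); exact/commute_sym/commute_racg_gen.
Qed.

(** Moves the two factors from the subtype of vertices in [J] to sets of vertices of [Gamma], where
    they index commuting sets of generators. *)
Lemma join_special_subgroup (J : {set Gamma}) : is_join (induced J) ->
  exists A B : set Gamma, [/\ A !=set0, B !=set0,
    forall s t, A s -> B t -> adj s t & [set` J] = A `|` B].
Proof.
case=> A [B [/set0Pn[a Aa] /set0Pn[b Bb] _ ABT adjAB]].
exists [set val x | x in [set` A]], [set val x | x in [set` B]]; split.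
- by exists (val a), a.
- by exists (val b), b.
- by move=> _ _ [x Ax <-] [y By <-]; exact: adjAB.
apply/seteqP; split=> [s /= Js|s /=].
  have : Sub s Js \in (A :|: B)%SET by rewrite ABT inE.
  by rewrite inE => /orP[]; [left|right]; exists (Sub s Js).
by case=> -[x _ <-]; exact: valP.
Qed.

Lemma commutation_closed_join H K h :
  connected_graph Gamma -> is_subgroup H -> commutation_closed H ->
  join_subgroup K -> K h -> H h -> h <> 1 -> H = setT.
Proof.
move=> conn sH ccH [J /join_special_subgroup[A [B [[s As] [t Bt] adjAB JE]]] ->].
rewrite /special_subgroup JE image_setU => Kh Hh h1.
have [|AH|BH] := commutation_closed_generatedU ccH _ Kh Hh h1.
- by move=> _ _ [x Ax <-] [y By <-]; exact/commute_racg_gen/adjAB.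
- by apply: (@commutation_closed_racg_gen _ s) => //; apply: AH; exists s.
- by apply: (@commutation_closed_racg_gen _ t) => //; apply: BH; exists t.
Qed.

End RightAngledCoxeterGroups.

Theorem theorem1p6 (Gamma : sgraph) (H : set (racg Gamma)) :
  connected_graph Gamma ->
  ~ is_join Gamma ->
  is_subgroup H ->
  infinite_set H ->
  H <> [set: racg Gamma]%classic ->
  malnormal H ->
  join_free H.
Proof.
move=> conn _ sH infH HneqT /malnormal_commutation_closed ccH.
split=> // h Hh h_inf [K joinK [g Kgh]]; apply: HneqT.
(* Since [x ^ g] is [g^-1 * x * g], the conjugate of [H] containing [g * h * g^-1] is the set of [x]
   with [x ^ g] in [H]. *)
have hE : (g * h * g^-1) ^ g = h by rewrite /conjg mulgVK mulKg.
have HgT : [set x | H (x ^ g)] = setT.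
  apply: (commutation_closed_join conn _ _ joinK Kgh).
  - exact: is_subgroup_conj.
  - exact: commutation_closed_conj.
  - by rewrite /= hE.
  (* Infinite order at exponent 1 says that [h] is nontrivial. *)
  - by move=> h1; apply: (h_inf 1%N) => //; rewrite -hE h1 conj1g expg1.
apply/seteqP; split=> // x _.
have : [set x | H (x ^ g)] (x ^ g^-1) by rewrite HgT.
by rewrite /= conjgKV.
Qed.
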